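(* In a tangent category with negatives, let $K:T^2(M)\to T(M)$ be a torsion-free affine vertical connection on $M$ (torsion-free: $c_MK=K$). Let $C_K:=c_{T(M)}T(K)K-T(K)K:T^3(M)\to T(M)$ and $R_K(w_1,w_2,s):=w_2T(w_1)T^2(s)C_K$. Then for all vector fields $w_1,w_2,s:M\to T(M)$, $$R_K(w_1,w_2,s)=\nabla_K^2(w_1,w_2,s)-\nabla_K^2(w_2,w_1,s),$$ where $\nabla_K(w,s):=wT(s)K$ and $$\nabla_K^2(w_1,w_2,s):=\nabla_K(w_1,\nabla_K(w_2,s))-\nabla_K(\nabla_K(w_1,w_2),s).$$
   Context: Conventions: composites are written in diagrammatic order ($fg$ means first $f$, then $g$). $\langle f,g\rangle$ is the induced map into a pullback, $\pi_0,\pi_1$ are projections. Component subscripts of natural transformations are often omitted. An additive bundle over $M$ is a map $q:E\to M$ whose finite wide pullbacks $E_n$ along itself exist, with maps $+_q:E_2\to E$, $0_q:M\to E$ making $q$ a commutative monoid in the slice over $M$. An additive bundle morphism $(f_1,f_0)$ from $q:E\to M$ to $q':E'\to M'$ is a pair $f_1:E\to E'$, $f_0:M\to M'$ with $f_1q'=qf_0$ preserving addition and zero. A tangent category is a category with a functor $T$ and natural transformations $p:T\to 1$, $0:1\to T$, $+:T_2\to T$, $\ell:T\to T^2$, $c:T^2\to T^2$ such that: each $(p_M,+_M,0_M)$ is an additive bundle, the wide pullbacks $T_nM$ of $p_M$ exist and are preserved by each $T^k$; $(\ell_M,0_M)$ is an additive bundle morphism from $(p_M,+_M,0_M)$ to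 $(T(p_M),T(+_M),T(0_M))$; $(c_M,1)$ is an additive bundle morphism from $(T(p_M),T(+_M),T(0_M))$ to $(p_{TM},+_{TM},0_{TM})$; $c^2=1$, $\ell c=\ell$, $\ell_M\ell_{TM}=\ell_MT(\ell_M)$, $T(c)cT(c)=cT(c)c$, $\ell_{TM}T(c_M)c_{TM}=c_MT(\ell_M)$; and the square with top $\langle\pi_0\ell,\pi_10\rangle T(+):T_2M\to T^2M$, left $\pi_0p=\pi_1p$, right $T(p)$, bottom $0_M$ is a pullback preserved by each $T^k$. It has negatives if there is a natural transformation $n:T\to T$ making each $p_M$ a fibrewise abelian group; $f-g:=\langle f,gn\rangle+$. Differences of maps into $T(M)$ are taken in $p_M$. A vector field on $M$ is a section $w:M\to T(M)$ of $p_M$. An affine vertical connection on $M$ is a map $K:T^2(M)\to T(M)$ with $\ell_MK=1$, $Kp=pp$, $K\ell_M=\ell_{TM}T(K)$ and $K\ell_M=T(\ell_M)c_{TM}T(K)$. *)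

(* Defs.v *)
From mathcomp Require Import all_boot.

Set Implicit Arguments.
Unset Strict Implicit.
Unset Printing Implicit Defensive.

Declare Scope cat_scope.
Delimit Scope cat_scope with cat.

Record category := Category {
  obj :> Type;
  Hom : obj -> obj -> Type;
  idm : forall A, Hom A A;
  comp : forall A B C, Hom A B -> Hom B C -> Hom A C;
  comp1m : forall A B (f : Hom A B), comp (idm A) f = f;
  compm1 : forall A B (f : Hom A B), comp f (idm B) = f;
  compA : forall A B C D (f : Hom A B) (g : Hom B C) (h : Hom C D),
    comp f (comp g h) = comp (comp f g) h }.

Arguments Hom {c} _ _.
Arguments idm {c} A.
Arguments comp {c A B C} _ _.

(* Diagrammatic order: [f ;; g] is first [f], then [g]. *)
Notation "f ;; g" := (comp f g)
  (at level 40, left associativity, format "f  ;;  g") : cat_scope.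
Local Open Scope cat_scope.

Record endofunctor (C : category) := Endofunctor {
  fobj :> C -> C;
  fmap : forall A B : C, Hom A B -> Hom (fobj A) (fobj B);
  fmap_id : forall A, fmap (idm A) = idm (fobj A);
  fmap_comp : forall (A B D : C) (f : Hom A B) (g : Hom B D),
    fmap (f ;; g) = fmap f ;; fmap g }.

Arguments fmap {C} F {A B} f : rename.

Definition idF (C : category) : endofunctor C :=
  @Endofunctor C id (fun _ _ f => f)
    (fun _ => erefl) (fun _ _ _ _ _ => erefl).

Lemma compF_id (C : category) (G F : endofunctor C) (A : C) :
  fmap G (fmap F (idm A)) = idm (G (F A)).
Proof. by rewrite !fmap_id. Qed.

Lemma compF_comp (C : category) (G F : endofunctor C) (A B D : C)
    (f : Hom A B) (g : Hom B D) :
  fmap G (fmap F (f ;; g)) = fmap G (fmap F f) ;; fmap G (fmap F g).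
Proof. by rewrite !fmap_comp. Qed.

Definition compF (C : category) (G F : endofunctor C) : endofunctor C :=
  @Endofunctor C (fun A => G (F A)) (fun _ _ f => fmap G (fmap F f))
    (compF_id G F) (@compF_comp C G F).

Fixpoint iterF (C : category) (F : endofunctor C) (k : nat) : endofunctor C :=
  if k is k'.+1 then compF F (iterF F k') else idF C.

Definition isPullback (C : category) (P A B D : C)
    (top : Hom P B) (left : Hom P A) (right : Hom B D) (bot : Hom A D) : Prop :=
  top ;; right = left ;; bot /\
  forall (X : C) (f : Hom X B) (g : Hom X A), f ;; right = g ;; bot ->
    exists! u : Hom X P, u ;; top = f /\ u ;; left = g.

(* A candidate for the wide pullback of [n] copies of [q]. Recording [base]
   beside the legs makes the case [n = 0] correct: its wide pullback is [M]. *)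
Record wideCone (C : category) (E M : C) (q : Hom E M) (n : nat) := WideCone {
  vertex :> C;
  base : Hom vertex M;
  leg : 'I_n -> Hom vertex E }.

Arguments base {C E M q n} P : rename.
Arguments leg {C E M q n} P i : rename.

(* The universal property is given by an operation [wlift], because the induced
   maps occur in the equations below. *)
Record isWidePullback (C : category) (E M : C) (q : Hom E M) (n : nat)
    (P : wideCone q n) : Type := IsWidePullback {
  leg_base : forall i, leg P i ;; q = base P;
  wlift : forall (X : C) (x : Hom X M) (f : 'I_n -> Hom X E),
    (forall i, f i ;; q = x) -> Hom X P;
  wlift_base : forall (X : C) (x : Hom X M) (f : 'I_n -> Hom X E) e,
    @wlift X x f e ;; base P = x;
  wlift_leg : forall (X : C) (x : Hom X M) (f : 'I_n -> Hom X E) e i,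
    @wlift X x f e ;; leg P i = f i;
  wlift_uniq : forall (X : C) (x : Hom X M) (f : 'I_n -> Hom X E) e
    (u : Hom X P), u ;; base P = x -> (forall i, u ;; leg P i = f i) ->
    u = @wlift X x f e }.

Arguments wlift {C E M q n P} H {X x f} e : rename.

Definition mapCone (C : category) (F : endofunctor C) (E M : C) (q : Hom E M)
    (n : nat) (P : wideCone q n) : wideCone (fmap F q) n :=
  @WideCone C (F E) (F M) (fmap F q) n (F P) (fmap F (base P))
    (fun i => fmap F (leg P i)).

Definition fam2 (T : Type) (f g : T) (i : 'I_2) : T :=
  if val i is 0 then f else g.

Lemma fam2_over (C : category) (E M X : C) (q : Hom E M) (f g : Hom X E) :
  f ;; q = g ;; q -> forall i, fam2 f g i ;; q = f ;; q.
Proof. by move=> e [[|i] ?]. Qed.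

Definition pairing (C : category) (E M : C) (q : Hom E M) (P : wideCone q 2)
    (H : isWidePullback P) (X : C) (f g : Hom X E) (e : f ;; q = g ;; q) :
  Hom X P := wlift H (fam2_over e).

Definition i0_2 : 'I_2 := @Ordinal 2 0 isT.
Definition i1_2 : 'I_2 := @Ordinal 2 1 isT.
Definition i0_3 : 'I_3 := @Ordinal 3 0 isT.
Definition i1_3 : 'I_3 := @Ordinal 3 1 isT.
Definition i2_3 : 'I_3 := @Ordinal 3 2 isT.

Lemma pairing_base (C : category) (E M : C) (q : Hom E M) (P : wideCone q 2)
    (H : isWidePullback P) (X : C) (f g : Hom X E) (e : f ;; q = g ;; q) :
  pairing H e ;; base P = f ;; q.
Proof. exact: wlift_base. Qed.

Lemma pairing_leg0 (C : category) (E M : C) (q : Hom E M) (P : wideCone q 2)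
    (H : isWidePullback P) (X : C) (f g : Hom X E) (e : f ;; q = g ;; q) :
  pairing H e ;; leg P i0_2 = f.
Proof. by rewrite wlift_leg. Qed.

Lemma pairing_leg1 (C : category) (E M : C) (q : Hom E M) (P : wideCone q 2)
    (H : isWidePullback P) (X : C) (f g : Hom X E) (e : f ;; q = g ;; q) :
  pairing H e ;; leg P i1_2 = g.
Proof. by rewrite wlift_leg. Qed.

Lemma pairing_uniq (C : category) (E M : C) (q : Hom E M) (P : wideCone q 2)
    (H : isWidePullback P) (X : C) (f g : Hom X E) (e : f ;; q = g ;; q)
    (u : Hom X P) :
  u ;; leg P i0_2 = f -> u ;; leg P i1_2 = g -> u = pairing H e.
Proof.
move=> u0 u1; apply: wlift_uniq => [|i].
  by rewrite -(leg_base H i0_2) compA u0.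
case: i => [[|[|//]] lti] /=.
  by rewrite /fam2 /= -u0; congr (_ ;; leg P _); apply: val_inj.
by rewrite /fam2 /= -u1; congr (_ ;; leg P _); apply: val_inj.
Qed.

Lemma legs_over (C : category) (E M : C) (q : Hom E M) (n : nat)
    (P : wideCone q n) (H : isWidePullback P) (i j : 'I_n) :
  leg P i ;; q = leg P j ;; q.
Proof. by rewrite !(leg_base H). Qed.

Definition bsum (C : category) (E M : C) (q : Hom E M) (P : wideCone q 2)
    (H : isWidePullback P) (add : Hom P E) (X : C) (f g : Hom X E)
    (e : f ;; q = g ;; q) : Hom X E := pairing H e ;; add.

Lemma bsum_overl (C : category) (E M : C) (q : Hom E M) (P : wideCone q 2)
    (H : isWidePullback P) (add : Hom P E) (add_over : add ;; q = base P)
    (X : C) (f g h : Hom X E) (e : f ;; q = g ;; q) :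
  g ;; q = h ;; q -> bsum H add e ;; q = h ;; q.
Proof. by move=> e'; rewrite /bsum -compA add_over pairing_base e. Qed.

Lemma bsum_overr (C : category) (E M : C) (q : Hom E M) (P : wideCone q 2)
    (H : isWidePullback P) (add : Hom P E) (add_over : add ;; q = base P)
    (X : C) (f g h : Hom X E) (e : g ;; q = h ;; q) :
  f ;; q = g ;; q -> f ;; q = bsum H add e ;; q.
Proof. by move=> e'; rewrite /bsum -compA add_over pairing_base e'. Qed.

Arguments bsum_overl {C E M q P} H {add} add_over {X f g h} e _.
Arguments bsum_overr {C E M q P} H {add} add_over {X f g h} e _.

Lemma unit_over (C : category) (E M : C) (q : Hom E M) (zero : Hom M E) :
  zero ;; q = idm M -> idm E ;; q = (q ;; zero) ;; q.
Proof. by move=> z; rewrite -compA z comp1m compm1. Qed.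

(* The monoid axioms are the diagrams on the universal elements: associativity
   on E_3, commutativity on E_2, unit law on E. *)
Record addBundle (C : category) (E M : C) (q : Hom E M) := AddBundle {
  bpow : forall n, wideCone q n;
  bpow_pb : forall n, isWidePullback (bpow n);
  badd : Hom (bpow 2) E;
  bzero : Hom M E;
  badd_over : badd ;; q = base (bpow 2);
  bzero_over : bzero ;; q = idm M;
  baddA :
    let H := bpow_pb 3 in
    bsum (bpow_pb 2) badd
      (bsum_overl (bpow_pb 2) badd_over
        (legs_over H i0_3 i1_3) (legs_over H i1_3 i2_3)) =
    bsum (bpow_pb 2) badd
      (bsum_overr (bpow_pb 2) badd_over
        (legs_over H i1_3 i2_3) (legs_over H i0_3 i1_3));
  baddC : bsum (bpow_pb 2) badd (legs_over (bpow_pb 2) i1_2 i0_2) = badd;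
  badd0 : bsum (bpow_pb 2) badd (unit_over bzero_over) = idm E }.

Arguments bpow {C E M q} B n : rename.
Arguments bpow_pb {C E M q} B n : rename.
Arguments badd {C E M q} B : rename.
Arguments bzero {C E M q} B : rename.

Lemma bpow_map_over (C : category) (E M E' M' : C) (q : Hom E M)
    (q' : Hom E' M') (B : addBundle q) (f1 : Hom E E') (f0 : Hom M M') :
  f1 ;; q' = q ;; f0 ->
  forall n (i : 'I_n), (leg (bpow B n) i ;; f1) ;; q' = base (bpow B n) ;; f0.
Proof. by move=> e n i; rewrite -compA e compA (leg_base (bpow_pb B n)). Qed.

(* The map E_n -> E'_n induced by a morphism of bundles. *)
Definition bpow_map (C : category) (E M E' M' : C) (q : Hom E M)
    (q' : Hom E' M') (B : addBundle q) (B' : addBundle q')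
    (f1 : Hom E E') (f0 : Hom M M') (e : f1 ;; q' = q ;; f0) (n : nat) :
  Hom (bpow B n) (bpow B' n) :=
  wlift (bpow_pb B' n) (bpow_map_over B e (n := n)).

Record isAddBundleMorphism (C : category) (E M E' M' : C) (q : Hom E M)
    (q' : Hom E' M') (B : addBundle q) (B' : addBundle q')
    (f1 : Hom E E') (f0 : Hom M M') : Prop := IsAddBundleMorphism {
  bm_over : f1 ;; q' = q ;; f0;
  bm_add : badd B ;; f1 = bpow_map B B' bm_over 2 ;; badd B';
  bm_zero : bzero B ;; f1 = f0 ;; bzero B' }.

Lemma fmap_over (C : category) (F : endofunctor C) (A B D : C)
    (f : Hom A B) (g : Hom B D) (h : Hom A D) :
  f ;; g = h -> fmap F f ;; fmap F g = fmap F h.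
Proof. by rewrite -fmap_comp => ->. Qed.

Lemma fmap_eq_over (C : category) (F : endofunctor C) (X E M : C)
    (f g : Hom X E) (q : Hom E M) :
  f ;; q = g ;; q -> fmap F f ;; fmap F q = fmap F g ;; fmap F q.
Proof. by rewrite -!fmap_comp => ->. Qed.

Lemma bsum_ext (C : category) (E M : C) (q : Hom E M) (P : wideCone q 2)
    (H : isWidePullback P) (add : Hom P E) (X : C) (f f' g g' : Hom X E)
    (e : f ;; q = g ;; q) (e' : f' ;; q = g' ;; q) :
  f = f' -> g = g' -> bsum H add e = bsum H add e'.
Proof.
move=> ff' gg'; congr (_ ;; add).
by apply: pairing_uniq; rewrite ?pairing_leg0 ?pairing_leg1.
Qed.

Lemma fmap_bsum (C : category) (F : endofunctor C) (E M : C) (q : Hom E M)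
    (P : wideCone q 2) (H : isWidePullback P)
    (H' : isWidePullback (mapCone F P)) (add : Hom P E) (X : C)
    (f g : Hom X E) (e : f ;; q = g ;; q)
    (e' : fmap F f ;; fmap F q = fmap F g ;; fmap F q) :
  @bsum C (F E) (F M) (fmap F q) (mapCone F P) H' (fmap F add) (F X)
    (fmap F f) (fmap F g) e' = fmap F (bsum H add e).
Proof.
rewrite /bsum fmap_comp; congr (_ ;; _); apply/esym/pairing_uniq => /=.
  by rewrite -fmap_comp pairing_leg0.
by rewrite -fmap_comp pairing_leg1.
Qed.

Definition mapBundle (C : category) (F : endofunctor C) (E M : C)
    (q : Hom E M) (B : addBundle q)
    (H : forall n, isWidePullback (mapCone F (bpow B n))) :
  addBundle (fmap F q).
Proof.
unshelve refine (@AddBundle C (F E) (F M) (fmap F q)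
  (fun n => mapCone F (bpow B n)) H (fmap F (badd B)) (fmap F (bzero B))
  (fmap_over F (badd_over B))
  (etrans (fmap_over F (bzero_over B)) (fmap_id F M)) _ _ _).
- move=> G.
  pose ea := bsum_overl (bpow_pb B 2) (badd_over B)
    (legs_over (bpow_pb B 3) i0_3 i1_3) (legs_over (bpow_pb B 3) i1_3 i2_3).
  pose eb := bsum_overr (bpow_pb B 2) (badd_over B)
    (legs_over (bpow_pb B 3) i1_3 i2_3) (legs_over (bpow_pb B 3) i0_3 i1_3).
  transitivity (bsum (H 2) (fmap F (badd B)) (fmap_eq_over F ea)).
    by apply: bsum_ext => //; exact: fmap_bsum.
  transitivity (bsum (H 2) (fmap F (badd B)) (fmap_eq_over F eb)).
    rewrite (fmap_bsum (bpow_pb B 2) _ _ ea) (fmap_bsum (bpow_pb B 2) _ _ eb).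
    by rewrite (baddA B).
  by apply: bsum_ext => //; apply/esym; exact: fmap_bsum.
- rewrite -[RHS](congr1 (fun f => fmap F f) (baddC B)).
  exact: fmap_bsum.
- pose e0 := unit_over (bzero_over B).
  transitivity (bsum (H 2) (fmap F (badd B)) (fmap_eq_over F e0)).
    by apply: bsum_ext; rewrite ?fmap_id ?fmap_comp.
  by rewrite (fmap_bsum (bpow_pb B 2) _ _ e0) (badd0 B) fmap_id.
Defined.

Record tangentBundles (C : category) := TangentBundles {
  tan : endofunctor C;
  tp : forall M : C, Hom (tan M) M;
  tp_nat : forall (M N : C) (f : Hom M N), fmap tan f ;; tp N = tp M ;; f;
  tbun : forall M, addBundle (tp M);
  tbun_pres : forall (k n : nat) (M : C),
    isWidePullback (mapCone (iterF tan k) (bpow (tbun M) n));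
  tzero_nat : forall (M N : C) (f : Hom M N),
    bzero (tbun M) ;; fmap tan f = f ;; bzero (tbun N);
  tadd_nat : forall (M N : C) (f : Hom M N),
    badd (tbun M) ;; fmap tan f =
    bpow_map (tbun M) (tbun N) (tp_nat f) 2 ;; badd (tbun N) }.

Arguments tan {C} t.
Arguments tp {C} t M.
Arguments tbun {C} t M.

Definition tpow (C : category) (t : tangentBundles C) (n : nat) (M : C) :
  wideCone (tp t M) n := bpow (tbun t M) n.
Definition tzero (C : category) (t : tangentBundles C) (M : C) :
  Hom M (tan t M) := bzero (tbun t M).

(* The additive bundle (T(p_M), T(+_M), T(0_M)); preservation is used at k = 1,
   where [iterF T 1] is convertible to [T]. *)
Definition Ttbun (C : category) (t : tangentBundles C) (M : C) :
  addBundle (fmap (tan t) (tp t M)) :=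
  @mapBundle C (tan t) _ _ _ (tbun t M) (fun n => tbun_pres t 1 n M).

Record tangentLiftFlip (C : category) := TangentLiftFlip {
  tlf_bun :> tangentBundles C;
  ell : forall M : C, Hom (tan tlf_bun M) (tan tlf_bun (tan tlf_bun M));
  flip : forall M : C,
    Hom (tan tlf_bun (tan tlf_bun M)) (tan tlf_bun (tan tlf_bun M));
  ell_nat : forall (M N : C) (f : Hom M N),
    ell M ;; fmap (tan tlf_bun) (fmap (tan tlf_bun) f) =
    fmap (tan tlf_bun) f ;; ell N;
  flip_nat : forall (M N : C) (f : Hom M N),
    flip M ;; fmap (tan tlf_bun) (fmap (tan tlf_bun) f) =
    fmap (tan tlf_bun) (fmap (tan tlf_bun) f) ;; flip N;
  ell_add : forall M, isAddBundleMorphism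
    (tbun tlf_bun M) (Ttbun tlf_bun M) (ell M) (tzero tlf_bun M);
  flip_add : forall M, isAddBundleMorphism
    (Ttbun tlf_bun M) (tbun tlf_bun (tan tlf_bun M))
    (flip M) (idm (tan tlf_bun M));
  flip_flip : forall M, flip M ;; flip M = idm (tan tlf_bun (tan tlf_bun M));
  ell_flip : forall M, ell M ;; flip M = ell M;
  ell_ell : forall M,
    ell M ;; ell (tan tlf_bun M) = ell M ;; fmap (tan tlf_bun) (ell M);
  flip_braid : forall M,
    fmap (tan tlf_bun) (flip M) ;; flip (tan tlf_bun M) ;;
      fmap (tan tlf_bun) (flip M) =
    flip (tan tlf_bun M) ;; fmap (tan tlf_bun) (flip M) ;;
      flip (tan tlf_bun M);
  ell_flip_flip : forall M,
    ell (tan tlf_bun M) ;; fmap (tan tlf_bun) (flip M) ;;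
      flip (tan tlf_bun M) =
    flip M ;; fmap (tan tlf_bun) (ell M) }.

Arguments ell {C} t M : rename.
Arguments flip {C} t M : rename.

Lemma vlift_over (C : category) (t : tangentLiftFlip C) (M : C) :
  (leg (tpow t 2 M) i0_2 ;; ell t M) ;; fmap (tan t) (tp t M) =
  (leg (tpow t 2 M) i1_2 ;; tzero t (tan t M)) ;; fmap (tan t) (tp t M).
Proof.
rewrite -!compA (bm_over (ell_add t M)) tzero_nat !compA.
by rewrite (legs_over (bpow_pb (tbun t M) 2) i0_2 i1_2).
Qed.

Definition vlift (C : category) (t : tangentLiftFlip C) (M : C) :
  Hom (tpow t 2 M) (tan t (tan t M)) :=
  pairing (bpow_pb (Ttbun t M) 2) (vlift_over t M) ;; badd (Ttbun t M).

Record tangentCategory := TangentCategory {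
  tcat :> category;
  tstr : tangentLiftFlip tcat;
  vlift_pb : forall (k : nat) (M : tcat),
    let Tk := iterF (tan tstr) k in
    isPullback (fmap Tk (vlift tstr M))
      (fmap Tk (leg (tpow tstr 2 M) i0_2 ;; tp tstr M))
      (fmap Tk (fmap (tan tstr) (tp tstr M)))
      (fmap Tk (tzero tstr M)) }.

Arguments tstr : clear implicits.

Definition T (X : tangentCategory) : endofunctor X := tan (tstr X).
Definition p (X : tangentCategory) (M : X) : Hom (T X M) M := tp (tstr X) M.
Definition zero (X : tangentCategory) (M : X) : Hom M (T X M) :=
  tzero (tstr X) M.
Definition l (X : tangentCategory) (M : X) : Hom (T X M) (T X (T X M)) :=
  ell (tstr X) M.
Definition c (X : tangentCategory) (M : X) :
  Hom (T X (T X M)) (T X (T X M)) := flip (tstr X) M.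

Definition tsum (X : tangentCategory) (M A : X) (f g : Hom A (T X M))
    (e : f ;; p M = g ;; p M) : Hom A (T X M) :=
  bsum (bpow_pb (tbun (tstr X) M) 2) (badd (tbun (tstr X) M)) e.

Lemma neg_unit_over (X : tangentCategory) (M : X) (n : Hom (T X M) (T X M)) :
  n ;; p M = p M -> idm (T X M) ;; p M = n ;; p M.
Proof. by move=> ->; rewrite comp1m. Qed.

Record negatives (X : tangentCategory) := Negatives {
  neg : forall M : X, Hom (T X M) (T X M);
  neg_nat : forall (M N : X) (f : Hom M N),
    neg M ;; fmap (T X) f = fmap (T X) f ;; neg N;
  neg_over : forall M, neg M ;; p M = p M;
  add_neg : forall M, tsum (neg_unit_over (neg_over M)) = p M ;; zero M }.

Lemma tsub_over (X : tangentCategory) (N : negatives X) (M A : X)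
    (f g : Hom A (T X M)) :
  f ;; p M = g ;; p M -> f ;; p M = (g ;; neg N M) ;; p M.
Proof. by rewrite -compA neg_over. Qed.

Definition tsub (X : tangentCategory) (N : negatives X) (M A : X)
    (f g : Hom A (T X M)) (e : f ;; p M = g ;; p M) : Hom A (T X M) :=
  tsum (tsub_over N e).

Lemma tsub_p (X : tangentCategory) (N : negatives X) (M A : X)
    (f g : Hom A (T X M)) (e : f ;; p M = g ;; p M) :
  tsub N e ;; p M = f ;; p M.
Proof.
by rewrite /tsub /tsum /bsum -compA (badd_over (tbun (tstr X) M)) pairing_base.
Qed.

Record vectorField (X : tangentCategory) (M : X) := VectorField {
  vf_map :> Hom M (T X M);
  vf_section : vf_map ;; p M = idm M }.

Lemma vf_over (X : tangentCategory) (M : X) (v w : vectorField M) :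
  v ;; p M = w ;; p M.
Proof. by rewrite !vf_section. Qed.

Lemma vfSub_section (X : tangentCategory) (N : negatives X) (M : X)
    (v w : vectorField M) : tsub N (vf_over v w) ;; p M = idm M.
Proof. by rewrite tsub_p vf_section. Qed.

Definition vfSub (X : tangentCategory) (N : negatives X) (M : X)
    (v w : vectorField M) : vectorField M := VectorField (vfSub_section N v w).

Record affineConnection (X : tangentCategory) (M : X) := AffineConnection {
  conn :> Hom (T X (T X M)) (T X M);
  l_conn : l M ;; conn = idm (T X M);
  conn_p : conn ;; p M = p (T X M) ;; p M;
  conn_l : conn ;; l M = l (T X M) ;; fmap (T X) conn;
  conn_l_T :
    conn ;; l M = fmap (T X) (l M) ;; c (T X M) ;; fmap (T X) conn }.

Definition torsionFree (X : tangentCategory) (M : X)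
    (K : affineConnection M) : Prop := c M ;; K = K.

Lemma curv_over (X : tangentCategory) (M : X) (K : affineConnection M) :
  (c (T X M) ;; fmap (T X) K ;; K) ;; p M = (fmap (T X) K ;; K) ;; p M.
Proof.
have pp : fmap (T X) (p M) ;; p M = p (T X M) ;; p M by exact: tp_nat.
have TKp : (fmap (T X) K ;; K) ;; p M
    = p (T X (T X M)) ;; p (T X M) ;; p M.
  by rewrite -compA conn_p !compA tp_nat -!compA conn_p.
rewrite -[_ ;; _ ;; K]compA -[LHS]compA TKp !compA.
have cp : c (T X M) ;; p (T X (T X M)) = fmap (T X) (p (T X M)).
  by rewrite (bm_over (flip_add (tstr X) (T X M))) compm1.
rewrite cp; congr (_ ;; _).
exact: tp_nat.
Qed.

Definition curv (X : tangentCategory) (N : negatives X) (M : X)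
    (K : affineConnection M) : Hom (T X (T X (T X M))) (T X M) :=
  tsub N (curv_over K).

(* R_K(w1, w2, s); note that [w2] comes first in the composite. *)
Definition curvR (X : tangentCategory) (N : negatives X) (M : X)
    (K : affineConnection M) (w1 w2 s : vectorField M) : Hom M (T X M) :=
  w2 ;; fmap (T X) w1 ;; fmap (T X) (fmap (T X) s) ;; curv N K.

Lemma nabla_section (X : tangentCategory) (M : X) (K : affineConnection M)
    (w s : vectorField M) : (w ;; fmap (T X) s ;; K) ;; p M = idm M.
Proof.
rewrite -compA conn_p -!compA (compA (fmap _ _)) tp_nat.
by rewrite !compA vf_section comp1m vf_section.
Qed.

Definition nabla (X : tangentCategory) (M : X) (K : affineConnection M)
    (w s : vectorField M) : vectorField M :=
  VectorField (nabla_section K w s).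

Definition nabla2 (X : tangentCategory) (N : negatives X) (M : X)
    (K : affineConnection M) (w1 w2 s : vectorField M) : vectorField M :=
  vfSub N (nabla K w1 (nabla K w2 s)) (nabla K (nabla K w1 w2) s).

(* Main.v *)
Require Import Defs.
From mathcomp Require Import all_boot.
(* Gives back to [compA] its meaning in a category. *)
Import Defs.

(** Write [D_w] for [nabla K w]. Unfolding the definitions, both sides of the
    identity contain [D_w2 D_w1 s], and the composites
    [A = w1 T(w2)] and [B = w2 T(w1) c] into [T^2 M] satisfy

      [A T^2(s) T(K) K = D_w1 D_w2 s]  and  [B T^2(s) T(K) K]
      is the first term of the curvature,

    while [A K = D_w1 w2] and, because [K] is torsion-free, [B K = D_w2 w1].
    So the claim is that the two second-order derivatives of [s], along [A]
    and along [B], differ by the first-order term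
    [D_(D_w1 w2) s - D_(D_w2 w1) s] (the derivative along the Lie bracket).

    The reason is that [A] and [B] have the same image under both projections
    of [T^2 M], so that [V = A - B] is vertical: [T(p)] sends it to a zero
    vector. By universality of the vertical lift, [V] is the sum, for [T(+)],
    of a lift [u l] and of a zero [v 0]. Now [K] is additive for both bundle
    structures on [T^2 M] ([conn_additive], [conn_additive_T]), since it
    commutes with the lift and the lift is a split monomorphism. Hence [K] sends
    [V] to [u], and [T^2(s) T(K) K] sends [V] to [u T(s) K = D_u s]
    ([conn_vertical]): no second-order part of [V] survives.
    What remains is arithmetic in the fibres of [p], carried by the relation
    [isSum]. *)

Set Implicit Arguments.
Unset Strict Implicit.
Unset Printing Implicit Defensive.

Local Open Scope cat_scope.

(** * Sums in additive bundles *)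

(** A relation rather than an operation: sums are defined only for maps over
    the same base point, and the relation can be rewritten freely, with no
    compatibility proof inside the terms. *)
Definition isSum (C : category) (E M : C) (q : Hom E M) (B : addBundle q)
    (A : C) (f g h : Hom A E) : Prop :=
  exists x : Hom A (bpow B 2),
    [/\ x ;; leg (bpow B 2) i0_2 = f, x ;; leg (bpow B 2) i1_2 = g
      & x ;; badd B = h].

Definition additive (C : category) (E M E' M' : C) (q : Hom E M)
    (q' : Hom E' M') (B : addBundle q) (B' : addBundle q') (k : Hom E E') :
    Prop :=
  forall (A : C) (f g h : Hom A E),
    isSum B f g h -> isSum B' (f ;; k) (g ;; k) (h ;; k).

Section Bundle.

Variables (C : category) (E M : C) (q : Hom E M) (B : addBundle q).

Lemma isSum_bsum (A : C) (f g : Hom A E) (e : f ;; q = g ;; q) :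
  isSum B f g (bsum (bpow_pb B 2) (badd B) e).
Proof.
by exists (pairing (bpow_pb B 2) e); rewrite pairing_leg0 pairing_leg1.
Qed.

Lemma isSum_exists (A : C) (f g : Hom A E) :
  f ;; q = g ;; q -> exists h, isSum B f g h.
Proof. by move=> e; eexists; exact: (isSum_bsum e). Qed.

Lemma isSum_over (A : C) (f g h : Hom A E) : isSum B f g h ->
  f ;; q = h ;; q /\ g ;; q = h ;; q.
Proof.
case=> x [<- <- <-].
by rewrite -!compA !(leg_base (bpow_pb B 2)) (badd_over B).
Qed.

Lemma isSum_uniq (A : C) (f g h h' : Hom A E) :
  isSum B f g h -> isSum B f g h' -> h = h'.
Proof.
case=> x [xf xg <-] [y [yf yg <-]]; congr (_ ;; _).
have e : f ;; q = g ;; q.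
  by rewrite -xf -xg -!compA (legs_over (bpow_pb B 2) i0_2 i1_2).
by rewrite (pairing_uniq (bpow_pb B 2) e xf xg)
  (pairing_uniq (bpow_pb B 2) e yf yg).
Qed.

Lemma isSum_pre (A A' : C) (t : Hom A' A) (f g h : Hom A E) :
  isSum B f g h -> isSum B (t ;; f) (t ;; g) (t ;; h).
Proof. by case=> x [<- <- <-]; exists (t ;; x); rewrite -!compA. Qed.

Lemma isSumC (A : C) (f g h : Hom A E) : isSum B f g h -> isSum B g f h.
Proof.
case=> x [<- <- <-]; rewrite -[in X in isSum _ _ _ X](baddC B).
exact/isSum_pre/isSum_bsum.
Qed.

Lemma isSum0 (A : C) (f : Hom A E) : isSum B f (f ;; q ;; bzero B) f.
Proof.
have := isSum_pre f (isSum_bsum (unit_over (bzero_over B))).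
by rewrite (badd0 B) !compA !compm1.
Qed.

Lemma isSumA (A : C) (f g h fg gh r : Hom A E) :
  isSum B f g fg -> isSum B g h gh -> isSum B fg h r -> isSum B f gh r.
Proof.
move=> sfg sgh sr.
have [eh er] := isSum_over sgh.
have [ef eg] := isSum_over sfg.
pose F (i : 'I_3) : Hom A E :=
  if val i is i'.+1 then (if i' is 0 then g else h) else f.
have eF i : F i ;; q = fg ;; q.
  case: i => [[|[|i]] lti]; rewrite /F //=.
  by rewrite er -eh eg.
pose t := wlift (bpow_pb B 3) eF.
pose H := bpow_pb B 3.
have t0 : t ;; leg _ i0_3 = f by rewrite /t wlift_leg.
have t1 : t ;; leg _ i1_3 = g by rewrite /t wlift_leg.
have t2 : t ;; leg _ i2_3 = h by rewrite /t wlift_leg.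
have s01 := isSum_pre t (isSum_bsum (legs_over H i0_3 i1_3)).
have s12 := isSum_pre t (isSum_bsum (legs_over H i1_3 i2_3)).
rewrite t0 t1 in s01; rewrite t1 t2 in s12.
have sl := isSum_pre t (isSum_bsum (bsum_overl (bpow_pb B 2) (badd_over B)
    (legs_over H i0_3 i1_3) (legs_over H i1_3 i2_3))).
have sr' := isSum_pre t (isSum_bsum (bsum_overr (bpow_pb B 2) (badd_over B)
    (legs_over H i1_3 i2_3) (legs_over H i0_3 i1_3))).
rewrite (baddA B) t2 (isSum_uniq s01 sfg) in sl.
rewrite t0 (isSum_uniq s12 sgh) in sr'.
by rewrite (isSum_uniq sr sl).
Qed.

End Bundle.

Lemma additive_comp (C : category) (E1 M1 E2 M2 E3 M3 : C) (q1 : Hom E1 M1)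
    (q2 : Hom E2 M2) (q3 : Hom E3 M3) (B1 : addBundle q1) (B2 : addBundle q2)
    (B3 : addBundle q3) (k : Hom E1 E2) (k' : Hom E2 E3) :
  additive B1 B2 k -> additive B2 B3 k' -> additive B1 B3 (k ;; k').
Proof. by move=> ak ak' A f g h /ak /ak'; rewrite !compA. Qed.

Lemma bundle_morphism_additive (C : category) (E M E' M' : C) (q : Hom E M)
    (q' : Hom E' M') (B : addBundle q) (B' : addBundle q') (k : Hom E E')
    (k0 : Hom M M') :
  isAddBundleMorphism B B' k k0 -> additive B B' k.
Proof.
case=> e eadd _ A f g h [x [<- <- <-]].
exists (x ;; bpow_map B B' e 2); rewrite -!compA eadd.
by split=> //; congr (_ ;; _); rewrite wlift_leg.
Qed.

(** A functor need only be applied to the sum of the universal pair: every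
    other sum in the image bundle is a restriction of its image. *)
Lemma additive_fmap (C : category) (F : endofunctor C) (E M E' M' : C)
    (q : Hom E M) (q' : Hom E' M') (B : addBundle q) (B' : addBundle q')
    (HB : forall n, isWidePullback (mapCone F (bpow B n)))
    (HB' : forall n, isWidePullback (mapCone F (bpow B' n))) (k : Hom E E') :
  additive B B' k -> additive (mapBundle HB) (mapBundle HB') (fmap F k).
Proof.
move=> ak A f g h [x [/= <- <- <-]].
have univ : isSum B (leg (bpow B 2) i0_2) (leg (bpow B 2) i1_2) (badd B).
  by exists (idm _); rewrite !comp1m.
have [y [y0 y1 ya]] := ak _ _ _ _ univ.
by exists (x ;; fmap F y); rewrite /= -!compA -!fmap_comp y0 y1 ya.
Qed.

(** * The structure maps of a tangent category *)

Section Tangent.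

Variable X : tangentCategory.

Notation tb M := (tbun (tstr X) M).
Notation Ttb M := (Ttbun (tstr X) M).
Notation dT f := (fmap (T X) f).

Lemma p_nat (M N : X) (f : Hom M N) : dT f ;; p N = p M ;; f.
Proof. exact: tp_nat. Qed.

Lemma zero_nat (M N : X) (f : Hom M N) : zero M ;; dT f = f ;; zero N.
Proof. exact: tzero_nat. Qed.

Lemma l_nat (M N : X) (f : Hom M N) : l M ;; dT (dT f) = dT f ;; l N.
Proof. exact: ell_nat. Qed.

Lemma c_nat (M N : X) (f : Hom M N) : c M ;; dT (dT f) = dT (dT f) ;; c N.
Proof. exact: flip_nat. Qed.

Lemma zero_p (M : X) : zero M ;; p M = idm M.
Proof. exact: (bzero_over (tb M)). Qed.

Lemma c_p (M : X) : c M ;; p (T X M) = dT (p M).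
Proof. by rewrite (bm_over (flip_add (tstr X) M)) compm1. Qed.

Lemma c_Tp (M : X) : c M ;; dT (p M) = p (T X M).
Proof. by rewrite -c_p compA (flip_flip (tstr X)) comp1m. Qed.

Lemma l_c (M : X) : l M ;; c M = l M.
Proof. exact: ell_flip. Qed.

Lemma l_p (M : X) : l M ;; p (T X M) = p M ;; zero M.
Proof. by rewrite -l_c -compA c_p (bm_over (ell_add (tstr X) M)). Qed.

Lemma zero_l (M : X) : zero M ;; l M = zero M ;; zero (T X M).
Proof.
rewrite -zero_nat.
by rewrite [LHS](bm_zero (ell_add (tstr X) M)).
Qed.

Lemma fmap_additive (M N : X) (f : Hom M N) : additive (tb M) (tb N) (dT f).
Proof.
apply: (bundle_morphism_additive (k0 := f)).
exists (@tp_nat _ (tstr X) M N f); [exact: tadd_nat | exact: tzero_nat].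
Qed.

Lemma fmap_additive_T (M N : X) (k : Hom (T X M) (T X N)) :
  additive (tb M) (tb N) k -> additive (Ttb M) (Ttb N) (dT k).
Proof. exact: additive_fmap. Qed.

Lemma c_additive (M : X) : additive (Ttb M) (tb (T X M)) (c M).
Proof. exact: bundle_morphism_additive (flip_add (tstr X) M). Qed.

(** Since the flip fixes the lift, the additivity of the lift for [T(+)]
    becomes additivity for the addition of the bundle [p] over [T M]. *)
Lemma l_additive (M : X) : additive (tb M) (tb (T X M)) (l M).
Proof.
rewrite -l_c; apply: additive_comp (@c_additive M).
exact: bundle_morphism_additive (ell_add (tstr X) M).
Qed.

(** The universal property of the vertical lift, read as a decomposition. *)
Lemma vertical_decomp (M A : X) (D : Hom A (T X (T X M)))
    (x : Hom A M) : D ;; dT (p M) = x ;; zero M ->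
  exists u v : Hom A (T X M), u ;; p M = v ;; p M /\
    isSum (Ttb M) (u ;; l M) (v ;; zero (T X M)) D.
Proof.
move=> eD; have [_ /(_ _ D x eD)] := vlift_pb (t := X) 0 M.
case=> y [[yD _] _].
exists (y ;; leg (tpow (tstr X) 2 M) i0_2).
exists (y ;; leg (tpow (tstr X) 2 M) i1_2); split.
  by rewrite -!compA (legs_over (bpow_pb (tb M) 2) i0_2 i1_2).
rewrite -yD -!compA; apply: isSum_pre; exact: isSum_bsum.
Qed.

(** * Additivity of an affine connection *)

(** A map is additive as soon as its composite with a split lift is. *)
Lemma additive_of_lift (M E M' : X) (q : Hom E M') (B : addBundle q)
    (r : Hom (T X (T X M)) (T X M)) (k : Hom E (T X M))
    (k0 : Hom M' M) :
  l M ;; r = idm _ -> k ;; p M = q ;; k0 ->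
  additive B (tb (T X M)) (k ;; l M) -> additive B (tb M) k.
Proof.
move=> lr kp akl A f g h sfg.
have [ef eg] := isSum_over sfg.
have /(isSum_exists (tb M)) [s ss] : f ;; k ;; p M = g ;; k ;; p M.
  by rewrite -!compA kp !compA ef eg.
have /akl := sfg; rewrite !compA => skl.
have /(congr1 (fun z => z ;; r)) := isSum_uniq (l_additive ss) skl.
by rewrite -!compA lr !compm1 => sE; rewrite sE in ss.
Qed.

Section Connection.

Variables (M : X) (K : affineConnection M).

(** [K l = l T(K)], and both [l] and [T(K)] preserve addition. *)
Lemma conn_additive : additive (tb (T X M)) (tb M) K.
Proof.
apply: (additive_of_lift (l_conn K) (conn_p K)); rewrite conn_l.
exact: additive_comp (@l_additive _) (@fmap_additive _ _ _).
Qed.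

(** [K l = T(l) c T(K)]: the flip exchanges [T(+)] with the addition of [p]. *)
Lemma conn_additive_T : additive (Ttb M) (tb M) K.
Proof.
apply: (additive_of_lift (k0 := p M) (l_conn K)).
  by rewrite (conn_p K) -p_nat.
rewrite conn_l_T; apply: additive_comp (@fmap_additive _ _ _).
exact: additive_comp (fmap_additive_T (@l_additive _)) (@c_additive _).
Qed.

Lemma zero_conn : zero (T X M) ;; K = p M ;; zero M.
Proof.
have E : zero _ ;; K ;; l M = zero _ ;; K ;; zero _.
  by rewrite -compA conn_l compA zero_l -compA zero_nat !compA.
(* [k l = k 0] makes [k] a zero vector: compare the projections by [p]. *)
have := congr1 (fun z => z ;; p _) E.
rewrite -!compA l_p zero_p compm1 => <-.
by rewrite !compA -(compA (zero _)) conn_p compA zero_p comp1m.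
Qed.

Lemma conn_split (A : X) (u v : Hom A (T X M))
    (D : Hom A (T X (T X M))) :
  isSum (Ttb M) (u ;; l M) (v ;; zero (T X M)) D ->
  u ;; p M = v ;; p M -> D ;; K = u.
Proof.
move=> sD euv; have := conn_additive_T sD.
rewrite -!compA l_conn zero_conn compm1 compA -euv => s.
exact: isSum_uniq s (isSum0 _ _).
Qed.

(** Along a vertical vector, the second covariant derivative reduces to the
    first one along the vector that [K] extracts: a lift [u l] passes through
    [T^2(s) T(K)] to become [u T(s) K l], and a zero stays a zero. *)
Lemma conn_vertical (A : X) (D : Hom A (T X (T X M))) (x : Hom A M)
    (s : Hom M (T X M)) : D ;; dT (p M) = x ;; zero M ->
  D ;; dT (dT s) ;; dT K ;; K = D ;; K ;; dT s ;; K.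
Proof.
move=> /vertical_decomp [u [v [euv sD]]].
rewrite (conn_split sD euv).
have := fmap_additive_T (additive_comp (fmap_additive s) conn_additive) sD.
rewrite -!compA zero_nat !fmap_comp (compA (l M)) l_nat -(compA (dT s) (l _)).
rewrite -conn_l !compA => sD'.
apply: conn_split sD' _.
by rewrite -!compA !conn_p !(compA (dT s)) p_nat !compA euv.
Qed.

End Connection.

(** * Differences *)

Section Negatives.

Variable N : negatives X.

Lemma isSum_neg (M A : X) (f : Hom A (T X M)) :
  isSum (tb M) f (f ;; neg N M) (f ;; p M ;; zero M).
Proof.
have := isSum_pre f (isSum_bsum (tb M) (neg_unit_over (neg_over N M))).
by rewrite compm1 [bsum _ _ _](add_neg N M) compA.
Qed.

Lemma isSum_cancel (M A : X) (f g h r : Hom A (T X M)) :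
  isSum (tb M) f h r -> isSum (tb M) g h r -> f = g.
Proof.
move=> sf sg.
have [_ eh] := isSum_over sf.
have /(isSum_exists (tb M)) [z sz] : r ;; p M = (h ;; neg N M) ;; p M.
  by rewrite -compA neg_over.
have recover k : isSum (tb M) k h r -> z = k.
  move=> sk; have := isSumA sk (isSum_neg h) sz.
  rewrite [h ;; p M]eh -[r ;; p M](isSum_over sk).1 => s.
  exact: isSum_uniq s (isSum0 _ _).
by rewrite -(recover f) // -(recover g).
Qed.

Lemma isSum_tsub (M A : X) (f g : Hom A (T X M))
    (e : f ;; p M = g ;; p M) : isSum (tb M) (tsub N e) g f.
Proof.
have sgn := isSumC (isSum_neg g).
rewrite -e in sgn.
have /(isSum_exists (tb M)) [z sz] : tsub N e ;; p M = g ;; p M.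
  by rewrite tsub_p.
have sd : isSum (tb M) f (g ;; neg N M) (tsub N e) by exact: isSum_bsum.
have := isSum_uniq (isSumA sd sgn sz) (isSum0 _ _).
by move: (tsub N e) sz => d sz zf; rewrite zf in sz.
Qed.

(** In terms of differences: [(a - x) - (b - y) = b' - b] as soon as
    [a - b' = d = x - y]. Adding [y] to [r + n] gives [b'], and adding [d] to
    that gives [a], which is also [m + x]; so [r + n] and [m] cancel. *)
Lemma isSum_rearrange (M A : X) (a b b' x y m n r d : Hom A (T X M)) :
  isSum (tb M) m x a -> isSum (tb M) n y b -> isSum (tb M) r b b' ->
  isSum (tb M) d b' a -> isSum (tb M) d y x -> isSum (tb M) r n m.
Proof.
move=> sm sn sr sa sx.
have [er eb] := isSum_over sr.
have [en ey] := isSum_over sn.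
have /(isSum_exists (tb M)) [k sk] : r ;; p M = n ;; p M.
  by rewrite en er -eb.
have /(isSum_exists (tb M)) [z sz] : k ;; p M = y ;; p M.
  by rewrite -(isSum_over sk).2 en ey.
have szb' := isSumA sk sn sz.
rewrite (isSum_uniq szb' sr) in sz.
have skx := isSumA sz (isSumC sx) (isSumC sa).
by rewrite (isSum_cancel sm skx).
Qed.

(** Two vectors of [T^2 M] with the same two projections differ by a vertical
    one, so their second covariant derivatives differ by a first-order term. *)
Lemma conn_difference (M A : X) (K : affineConnection M)
    (s : Hom M (T X M)) (f g : Hom A (T X (T X M))) (d : Hom A (T X M)) :
  f ;; p (T X M) = g ;; p (T X M) ->
  f ;; dT (p M) = g ;; dT (p M) ->
  isSum (tb M) d (g ;; K) (f ;; K) ->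
  isSum (tb M) (d ;; dT s ;; K) (g ;; dT (dT s) ;; dT K ;; K)
    (f ;; dT (dT s) ;; dT K ;; K).
Proof.
move=> ep eTp sd; have sD := isSum_tsub ep; set D := tsub N ep in sD.
have DTp : D ;; dT (p M) = f ;; dT (p M) ;; p M ;; zero M.
  have := fmap_additive (p M) sD; rewrite -eTp => sDp.
  exact: isSum_cancel sDp (isSumC (isSum0 _ _)).
have dE : d = D ;; K.
  exact: isSum_cancel sd (conn_additive K sD).
rewrite dE -(conn_vertical K s DTp).
apply: conn_additive; apply: fmap_additive; exact: fmap_additive.
Qed.

End Negatives.

End Tangent.

(** * The curvature as an antisymmetrised second covariant derivative *)

Theorem proposition3p33 (X : tangentCategory) (N : negatives X) (M : X)
    (K : affineConnection M) (hK : torsionFree K) (w1 w2 s : vectorField M) :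
  curvR N K w1 w2 s = vfSub N (nabla2 N K w1 w2 s) (nabla2 N K w2 w1 s).
Proof.
have e12 : vf_map (nabla K w1 w2) ;; p M = vf_map (nabla K w2 w1) ;; p M.
  exact: vf_over.
pose u := tsub N e12.
have su : isSum (tbun (tstr X) M) u (nabla K w2 w1) (nabla K w1 w2).
  exact: isSum_tsub.
pose f := w1 ;; fmap (T X) w2.
pose g := w2 ;; fmap (T X) w1 ;; c M.
have fp : f ;; p (T X M) = w2.
  by rewrite -compA p_nat compA vf_section comp1m.
have gp : g ;; p (T X M) = w2.
  by rewrite -compA c_p -compA -fmap_comp vf_section fmap_id compm1.
have fTp : f ;; fmap (T X) (p M) = w1.
  by rewrite -compA -fmap_comp vf_section fmap_id compm1.
have gTp : g ;; fmap (T X) (p M) = w1.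
  by rewrite -compA c_Tp -compA p_nat compA vf_section comp1m.
have gK : g ;; K = nabla K w2 w1 by rewrite -compA hK.
have sd : isSum (tbun (tstr X) M) (u ;; fmap (T X) s ;; K)
    (g ;; fmap (T X) (fmap (T X) s) ;; fmap (T X) K ;; K)
    (nabla K w1 (nabla K w2 s)).
  have -> : vf_map (nabla K w1 (nabla K w2 s)) =
      f ;; fmap (T X) (fmap (T X) s) ;; fmap (T X) K ;; K.
    by rewrite /= !fmap_comp !compA.
  by apply: (conn_difference N); rewrite ?fp ?fTp // gK.
have sx : isSum (tbun (tstr X) M) (u ;; fmap (T X) s ;; K)
    (nabla K (nabla K w2 w1) s) (nabla K (nabla K w1 w2) s).
  by apply: conn_additive; apply: fmap_additive.
have sr : isSum (tbun (tstr X) M) (curvR N K w1 w2 s)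
    (nabla K w2 (nabla K w1 s))
    (g ;; fmap (T X) (fmap (T X) s) ;; fmap (T X) K ;; K).
  pose h := w2 ;; fmap (T X) w1 ;; fmap (T X) (fmap (T X) s).
  have -> : vf_map (nabla K w2 (nabla K w1 s)) = h ;; (fmap (T X) K ;; K).
    by rewrite /= !fmap_comp !compA.
  have -> : g ;; fmap (T X) (fmap (T X) s) = h ;; c (T X M).
    by rewrite /g /h -(compA _ (c M)) c_nat !compA.
  have := isSum_pre h (isSum_tsub N (curv_over K)).
  by rewrite -(compA (h ;; _)) -(compA h (c _)) (compA (c _)).
have sub (v w : vectorField M) : isSum (tbun (tstr X) M) (vfSub N v w) w v.
  exact: isSum_tsub.
apply: (isSum_cancel N _ (sub _ _)).
exact: (isSum_rearrange N (sub _ _) (sub _ _) sr sd sx).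
Qed.
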